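(* Let $p\ge 1$, let $\lambda\ge 0$, and let $\mathcal{M}$ be a collection of expofam-type estimators on $\mathrm{Sym}_p$ whose generators $A$ are invariant under conjugation by diagonal sign matrices, i.e. $A(D\theta D^{-1})=A(\theta)$ for all $\theta\in\mathrm{Sym}_p$ and all diagonal matrices $D$ with diagonal entries in $\{-1,+1\}$, and whose penalties are $h_C=\lambda\|\cdot\|_1$, where $\|\theta\|_1=\sum_{i,j}|\theta_{ij}|$. Then the function $X\mapsto \mathrm{SLT}_\lambda(X)$ is computationally sufficient for $\mathcal{M}$. Moreover, every $T\in\mathcal{M}$ satisfies, for every $X\in\mathrm{Sym}_p$, $$\mathrm{SLC}_\lambda(|X|)\circ T(X)\subseteq T(X),$$ where $\mathrm{SLC}_\lambda(|X|)\circ T(X)=\{\mathrm{SLC}_\lambda(|X|)\circ\theta : \theta\in T(X)\}$.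
   Context: $\mathrm{Sym}_p=\{x\in\mathbb{R}^{p\times p}: x=x^T\}$ with the trace inner product $\langle x,y\rangle=\sum_{i,j}x_{ij}y_{ij}$; $\circ$ is the entrywise product; $|X|$ is the matrix of entrywise absolute values. Expofam-type estimator on a Euclidean space $\mathcal{X}$ (here $\mathcal{X}=\mathrm{Sym}_p$): a set-valued function of the form $$T(x)=\operatorname{arg\,min}_{\theta\in\mathcal{X}}\; A(\theta)-\langle x,\theta\rangle+h_C(\theta)$$ (the set of minimizers, possibly empty or with several elements), where the generator $A:\mathcal{X}\to\mathbb{R}\cup\{+\infty\}$ is closed (lower semicontinuous), convex and proper (finite at some point), $C\subseteq\mathcal{X}$ is a nonempty closed convex set (the penalty support set), and $h_C(\theta)=\sup_{z\in C}\langle z,\theta\rangle$. The penalty $h_C=\lambda\|\cdot\|_1$ corresponds to $C=\{Z\in\mathrm{Sym}_p:|Z_{ij}|\le\lambda\text{ for all }i,j\}$. Single-linkage: for a symmetric $p\times p$ matrix $W$ and $\tau\in\mathbb{R}$, $\mathrm{SLC}_\tau(W)$ is the $p\times p$ matrix with $$[\mathrm{SLC}_\tau(W)]_{ij}=\begin{cases}1&\text{if } i=j \text{ or } \max_P\min_{uv\in P}W_{uv}>\tau,\\0&\text{otherwise,}\end{cases}$$ where the maximum is over all paths $P$ between $i$ and $j$ in the complete undirected graph on $\{1,\dots,p\}$ and the minimum is over the edges $uv$ of $P$. The single-linkage thresholding operator is $\mathrm{SLT}_\tau(W)=\mathrm{SLC}_\tau(|W|)\circ W$. Computational sufficiency: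 for a collection $\mathcal{M}$ of set-valued functions on $\mathcal{X}$, let $\operatorname{dom}T=\{x\in\mathcal{X}:T(x)\neq\emptyset\}$. A function $R$ on $\mathcal{X}$ is computationally sufficient for $\mathcal{M}$ if for each $T\in\mathcal{M}$ there exists a set-valued function $f$ such that $f(T,R(x))\neq\emptyset$ for all $x\in\operatorname{dom}T$ and $f(T,R(x))\subseteq T(x)$ for all $x\in\mathcal{X}$. *)

(* Defs.v *)
From HB Require Import structures.
From mathcomp Require Import all_boot all_order all_algebra.
From mathcomp Require Import all_classical all_reals all_analysis.

Set Implicit Arguments.
Unset Strict Implicit.
Unset Printing Implicit Defensive.

Import Order.TTheory GRing.Theory Num.Theory.
Import numFieldNormedType.Exports.

Local Open Scope classical_set_scope.
Local Open Scope ring_scope.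

Definition is_sym (R : realType) (p : nat) : {pred 'M[R]_p} :=
  [pred x | x == x^T].

Record symM (R : realType) (p : nat) :=
  SymM { symM_val :> 'M[R]_p ; _ : symM_val \in @is_sym R p }.

HB.instance Definition _ (R : realType) (p : nat) :=
  [isSub of symM R p for @symM_val R p].
HB.instance Definition _ (R : realType) (p : nat) :=
  [Choice of symM R p by <:].

Fact is_sym_submod (R : realType) (p : nat) : submod_closed (@is_sym R p).
Proof.
split=> [|a x y /eqP hx /eqP hy]; first by rewrite inE trmx0.
by rewrite inE linearD linearZ /= -hx -hy.
Qed.

HB.instance Definition _ (R : realType) (p : nat) :=
  GRing.isSubmodClosed.Build R 'M[R]_p (@is_sym R p) (@is_sym_submod R p).
HB.instance Definition _ (R : realType) (p : nat) :=
  [SubChoice_isSubLmodule of symM R p by <:].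

(* The Euclidean topology, as the one induced by the inclusion in 'M[R]_p. *)
HB.instance Definition _ (R : realType) (p : nat) :=
  Topological.copy (symM R p) (initial_topology (@symM_val R p)).

Definition tr_inner (R : realType) (p : nat) (x y : symM R p) : R :=
  \sum_i \sum_j x i j * y i j.

Definition l1norm (R : realType) (p : nat) (x : symM R p) : R :=
  \sum_i \sum_j `|x i j|.

Definition convex_efun (R : realType) (E : lmodType R)
    (f : convex_lmodType E -> \bar R) : Prop :=
  forall (t : {i01 R}) (x y : convex_lmodType E),
    (f (conv t x y) <= t%:num%:E * f x + (1 - t%:num)%:E * f y)%E.

(* The functions A : Sym_p -> R u {+oo} that are closed, convex and proper. *)
Definition generator (R : realType) (p : nat) (A : symM R p -> \bar R) : Prop :=
  [/\ forall x, A x != -oo%E,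
      exists x, A x \is a fin_num,
      convex_efun A
    & lower_semicontinuous A].

Definition penalty_support (R : realType) (p : nat) (C : set (symM R p)) :
    Prop :=
  [/\ C !=set0, closed C & convex_set C].

Definition support_fun (R : realType) (p : nat) (C : set (symM R p))
    (theta : symM R p) : \bar R :=
  ereal_sup [set (tr_inner z theta)%:E | z in C].

Definition argmin (R : realType) (X : Type) (f : X -> \bar R) : set X :=
  [set x | forall y, (f x <= f y)%E].

Definition expofam (R : realType) (p : nat) (A : symM R p -> \bar R)
    (C : set (symM R p)) : symM R p -> set (symM R p) :=
  fun x => argmin (fun theta =>
    A theta - (tr_inner x theta)%:E + support_fun C theta)%E.

(* For every theta and D the matrix D theta D^-1 is again symmetric, since
   D^-1 = D; [theta'] is that matrix as an element of [symM R p]. *)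
Definition sign_invariant (R : realType) (p : nat) (A : symM R p -> \bar R) :
    Prop :=
  forall D : 'M[R]_p,
    is_diag_mx D -> (forall i, D i i = 1 \/ D i i = -1) ->
  forall theta theta' : symM R p,
    symM_val theta' = D *m theta *m invmx D -> A theta' = A theta.

(* A path from i to j in the complete graph on 'I_p is i :: s with distinct
   vertices and last vertex j; its edges are the pairs in [zip (i :: s) s].
   Distinctness forces size s < p, so s : p.-bseq ranges over all paths.
   For i != j the set of paths is nonempty and each has an edge, so neither
   default value -oo, +oo is ever attained. *)
Definition path_min (R : realType) (p : nat) (W : 'M[R]_p) (i : 'I_p)
    (s : seq 'I_p) : \bar R :=
  \big[Order.min/+oo%E]_(e <- zip (i :: s) s) (W e.1 e.2)%:E.

Definition max_path_min (R : realType) (p : nat) (W : 'M[R]_p) (i j : 'I_p) :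
    \bar R :=
  \big[Order.max/-oo%E]_(s : p.-bseq 'I_p | uniq (i :: s) && (last i s == j))
    path_min W i s.

Definition slc (R : realType) (p : nat) (tau : R) (W : 'M[R]_p) : 'M[R]_p :=
  \matrix_(i, j) ((i == j) || (tau%:E < max_path_min W i j)%E)%:R.

Definition hadamard (R : realType) (p : nat) (x y : 'M[R]_p) : 'M[R]_p :=
  map2_mx *%R x y.

Definition abs_mx (R : realType) (p : nat) (x : 'M[R]_p) : 'M[R]_p :=
  map_mx Num.norm x.

Definition slt (R : realType) (p : nat) (tau : R) (W : 'M[R]_p) : 'M[R]_p :=
  hadamard (slc tau (abs_mx W)) W.

Definition dom (X Z : Type) (T : X -> set Z) : set X := [set x | T x !=set0].

Definition comp_sufficient (X Y : Type) (M : set (X -> set X)) (r : X -> Y) :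
    Prop :=
  forall T, M T -> exists f : (X -> set X) -> Y -> set X,
    (forall x, dom T x -> f T (r x) !=set0) /\
    (forall x, f T (r x) `<=` T x).

(* Main.v *)
Require Import Defs.
From HB Require Import structures.
From mathcomp Require Import all_boot all_order all_algebra.
From mathcomp Require Import all_classical all_reals all_analysis.
From mathcomp Require Import ring.

Set Implicit Arguments.
Unset Strict Implicit.
Unset Printing Implicit Defensive.

Import Order.TTheory GRing.Theory Num.Theory.
Import numFieldNormedType.Exports.

Local Open Scope classical_set_scope.
Local Open Scope ring_scope.

(** If theta minimizes the objective of X, then so does theta restricted to
    the single-linkage blocks of X (the entries between two clusters set to
    zero), because the restriction increases neither the generator nor the
    sum of the two other terms.  For the generator A: when D is a diagonal sign
    matrix that is constant on each cluster, the midpoint of theta and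
    D theta D is theta with the entries between the two sign classes set to
    zero, and A is no larger there, being convex and invariant under D; running
    over the bipartitions that isolate one cluster removes every entry between
    clusters ([generator_block_restrict]).  For the rest: an entry X_ij between
    two clusters has |X_ij| <= lambda, since otherwise the edge ij would join
    them; so deleting theta_ij costs at most X_ij theta_ij, which the penalty
    lambda |theta_ij| repays ([linear_l1_block_restrict]).

    Let Y be the thresholded matrix, i.e. X itself restricted to its blocks.
    Y has the same clusters as X ([cluster_slt]), and on block matrices the
    objectives of X and Y coincide, since they only see the entries of X inside
    the blocks.  So restriction maps minimizers for X to minimizers for Y and
    conversely ([argmin_transfer]): solving the problem for Y and restricting
    the solution to the clusters of Y gives a solution for X. *)

(** * Single-linkage clusters as connected components *)

Definition edge (R : realType) (p : nat) (tau : R) (W : 'M[R]_p) :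
  rel 'I_p := [rel u v | tau < W u v].

Lemma lt_path_min (R : realType) (p : nat) (tau : R) (W : 'M[R]_p)
    (i : 'I_p) (s : seq 'I_p) :
  (tau%:E < path_min W i s)%E = path (edge tau W) i s.
Proof.
rewrite /path_min; elim: s i => [|j s IHs] i; first by rewrite big_nil ltry.
by rewrite /= big_cons /= lt_min IHs lte_fin.
Qed.

(** A walk can be shortened to a path, so the bottleneck value of the best
    path exceeds [tau] exactly when the edges of weight above [tau] connect
    the two vertices. *)
Lemma slc_connect (R : realType) (p : nat) (tau : R) (W : 'M[R]_p)
    (i j : 'I_p) :
  slc tau W i j = (connect (edge tau W) i j)%:R.
Proof.
rewrite mxE; congr (_%:R).
have [->|neq_ij] /= := eqVneq i j; first by rewrite connect0.
congr nat_of_bool; apply/bigmax_gtP/connectP => [[//|[s /andP[us /eqP <-]]]|].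
  by rewrite lt_path_min => es; exists s.
move=> [s /shortenP[s' es' us' _] ->]; right.
(* the vertices of a path are distinct, so it has fewer than p edges *)
have size_s' : (size s' <= p)%N.
  rewrite -[p in X in (_ <= X)%N]card_ord -(card_uniqP _); last first.
    by case/andP: us'.
  exact: max_card.
exists (Bseq size_s'); first by rewrite us' eqxx.
by rewrite lt_path_min.
Qed.

Definition cluster (R : realType) (p : nat) (tau : R) (W : 'M[R]_p) :
  'I_p -> 'I_p := fingraph.root (edge tau (abs_mx W)).

Lemma symM_sym (R : realType) (p : nat) (x : symM R p) (i j : 'I_p) :
  x i j = x j i.
Proof. by case: x => x /= /eqP xT; rewrite {1}xT mxE. Qed.

Lemma edge_abs_sym (R : realType) (p : nat) (tau : R) (x : symM R p) :
  connect_sym (edge tau (abs_mx x)).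
Proof. by apply: sym_connect_sym => i j; rewrite /edge /= !mxE symM_sym. Qed.

Lemma slc_cluster (R : realType) (p : nat) (tau : R) (x : symM R p)
    (i j : 'I_p) :
  slc tau (abs_mx x) i j = (cluster tau x i == cluster tau x j)%:R.
Proof. by rewrite slc_connect (root_connect (@edge_abs_sym _ _ _ _)). Qed.

Lemma cluster_separates (R : realType) (p : nat) (tau : R) (x : symM R p)
    (i j : 'I_p) :
  cluster tau x i != cluster tau x j -> `|x i j| <= tau.
Proof.
rewrite (root_connect (@edge_abs_sym _ _ _ _)) leNgt; apply: contra => tau_lt.
by apply: connect1; rewrite /edge /= mxE.
Qed.

(** * Block restriction *)

(** Blocks are given by a labelling of the indices rather than by a 0-1
    matrix: symmetry is then automatic, and a list of labellings is again
    a labelling. *)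
Definition block_mx_of (R : realType) (p : nat) (K : eqType) (c : 'I_p -> K)
    (x : 'M[R]_p) : 'M[R]_p :=
  \matrix_(i, j) ((c i == c j)%:R * x i j).

Lemma block_mx_of_sym (R : realType) (p : nat) (K : eqType) (c : 'I_p -> K)
    (x : symM R p) : block_mx_of c x \in @Defs.is_sym R p.
Proof.
by apply/eqP/matrixP => i j; rewrite !mxE eq_sym symM_sym.
Qed.

Definition block_restrict (R : realType) (p : nat) (K : eqType)
    (c : 'I_p -> K) (x : symM R p) : symM R p :=
  SymM (block_mx_of_sym c x).

Lemma symM_eq (R : realType) (p : nat) (x y : symM R p) :
  (forall i j, x i j = y i j) -> x = y.
Proof. by move=> xy; apply/val_inj/matrixP. Qed.

Lemma block_restrictE (R : realType) (p : nat) (K : eqType)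
    (c : 'I_p -> K) (x : symM R p) (i j : 'I_p) :
  block_restrict c x i j = (c i == c j)%:R * x i j.
Proof. by rewrite mxE. Qed.

Lemma eq_block_restrict (R : realType) (p : nat) (K L : eqType)
    (c : 'I_p -> K) (d : 'I_p -> L) :
  (forall i j, (c i == c j) = (d i == d j)) ->
  @block_restrict R p K c =1 block_restrict d.
Proof. by move=> cd x; apply: symM_eq => i j; rewrite !block_restrictE cd. Qed.

Lemma hadamard_slc (R : realType) (p : nat) (tau : R) (x y : symM R p) :
  hadamard (slc tau (abs_mx x)) y = block_restrict (cluster tau x) y.
Proof. by apply/matrixP => i j; rewrite [LHS]mxE slc_cluster block_restrictE. Qed.

(** Every edge above [tau] lies inside a cluster, so it survives
    thresholding; the entries set to zero are not above [tau >= 0]. *)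
Lemma cluster_slt (R : realType) (p : nat) (tau : R) (x : symM R p) :
  0 <= tau -> cluster tau (slt tau x) =1 cluster tau x.
Proof.
move=> tau_ge0; apply: eq_root => i j.
rewrite /edge /slt hadamard_slc /= !mxE.
have [eq_c|/cluster_separates x_le] := eqVneq; first by rewrite mul1r.
by rewrite mul0r normr0 !ltNge tau_ge0 x_le.
Qed.

(** * Block restriction does not increase the objective *)

(** For a two-valued labelling [b], let [D] have sign [(-1) ^ b i] at [i].
    Conjugation by [D] negates the entries between the two blocks and keeps
    the others, so the midpoint of [x] and [D x D] is the block restriction
    of [x]. *)
Lemma generator_block_restrict_bool (R : realType) (p : nat)
    (A : symM R p -> \bar R) (b : 'I_p -> bool) (x : symM R p) :
  convex_efun A -> sign_invariant A -> (A (block_restrict b x) <= A x)%E.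
Proof.
move=> cvxA invA.
pose d : 'rV[R]_p := \row_i (-1) ^+ b i.
pose D := diag_mx d.
have DD : D *m D = 1%:M.
  by rewrite mulmx_diag; apply/matrixP => i j; rewrite !mxE -expr2 sqrr_sign.
have [uD _] := mulmx1_unit DD.
have invD : invmx D = D by rewrite -[RHS](mulKmx uD) DD mulmx1.
have DxDE i j : (D *m x *m D) i j = (-1) ^+ b i * x i j * (-1) ^+ b j.
  by rewrite mul_mx_diag mxE mul_diag_mx !mxE.
have DxD_sym : D *m x *m D \in @Defs.is_sym R p.
  apply/eqP/matrixP => i j; rewrite [RHS]mxE !DxDE symM_sym.
  by rewrite mulrC mulrA [_ * x j i]mulrC mulrA [_ * x j i]mulrC.
pose y := SymM DxD_sym.
have Ay : A y = A x.
  apply: (invA D); last by rewrite invD.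
    exact: diag_mx_is_diag.
  by move=> i; rewrite !mxE eqxx; case: (b i); [right|left]; rewrite ?expr1.
have half_ge0 : 0 <= 2^-1 :> R by rewrite invr_ge0.
have half_le1 : 2^-1 <= 1 :> R by rewrite invf_le1 // ler1n.
have half : 1 - 2^-1 = 2^-1 :> R by field.
have midpoint : 2^-1 *: x + (1 - 2^-1) *: y = block_restrict b x.
  apply: symM_eq => i j; rewrite block_restrictE [LHS]mxE.
  rewrite [X in X + _]mxE [X in _ + X]mxE DxDE.
  by case: (b i) (b j) => [] []; rewrite /=; field.
have /le_trans : (A (block_restrict b x)
    <= (2^-1)%:E * A x + (1 - 2^-1)%:E * A y)%E.
  by rewrite -midpoint; exact: (cvxA (Itv01 half_ge0 half_le1) x y).
apply.
rewrite Ay half -ge0_muleDl ?lee_fin // -EFinD -[X in (_ + X)%:E]half.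
by rewrite addrC subrK mul1e.
Qed.

(** Two labels differ exactly when the indicator of some label separates
    them, so the restriction is a succession of two-block restrictions, one
    for each value of the labelling. *)
Lemma generator_block_restrict (R : realType) (p : nat)
    (A : symM R p -> \bar R) (K : eqType) (c : 'I_p -> K) (x : symM R p) :
  convex_efun A -> sign_invariant A -> (A (block_restrict c x) <= A x)%E.
Proof.
move=> cvxA invA.
pose ind (s : seq K) i := [seq c i == k | k <- s].
rewrite (@eq_block_restrict _ _ _ _ _ (ind (codom c))); last first.
  move=> i j; apply/eqP/eqP => [cij|/eq_in_map ind_ij]; first by rewrite /ind cij.
  by apply/esym/eqP; rewrite -ind_ij ?codom_f.
elim: (codom c) => [|k s IHs].
  suff -> : block_restrict (ind [::]) x = x by [].
  by apply: symM_eq => i j; rewrite block_restrictE eqxx mul1r.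
apply: le_trans IHs.
suff -> : block_restrict (ind (k :: s)) x =
    block_restrict (fun i => c i == k) (block_restrict (ind s) x).
  exact: generator_block_restrict_bool.
apply: symM_eq => i j; rewrite !block_restrictE /= eqseq_cons.
by rewrite mulrA -natrM mulnb.
Qed.

(** The loss of the data term between two blocks is at most the gain of the
    penalty there, entry by entry: [x i j * t <= lambda * |t|]. *)
Lemma linear_l1_block_restrict (R : realType) (p : nat) (lambda : R)
    (K : eqType) (c : 'I_p -> K) (x theta : symM R p) :
  (forall i j, c i != c j -> `|x i j| <= lambda) ->
  lambda * l1norm (block_restrict c theta)
      - tr_inner x (block_restrict c theta)
    <= lambda * l1norm theta - tr_inner x theta.
Proof.
move=> x_le; rewrite /l1norm /tr_inner !mulr_sumr -!sumrB.
apply: ler_sum => i _; rewrite !mulr_sumr -!sumrB; apply: ler_sum => j _.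
rewrite block_restrictE.
have [_|/x_le x_le_ij] := eqVneq; first by rewrite !mul1r.
rewrite mul0r normr0 !mulr0 subr0 subr_ge0.
by rewrite (le_trans (ler_norm _)) // normrM ler_wpM2r.
Qed.

Definition l1_objective (R : realType) (p : nat) (lambda : R)
    (A : symM R p -> \bar R) (x theta : symM R p) : \bar R :=
  (A theta - (tr_inner x theta)%:E + (lambda * l1norm theta)%:E)%E.

Lemma l1_objective_block_restrict (R : realType) (p : nat) (lambda : R)
    (A : symM R p -> \bar R) (K : eqType) (c : 'I_p -> K)
    (x theta : symM R p) :
  convex_efun A -> sign_invariant A ->
  (forall i j, c i != c j -> `|x i j| <= lambda) ->
  (l1_objective lambda A x (block_restrict c theta)
     <= l1_objective lambda A x theta)%E.
Proof.
move=> cvxA invA x_le; rewrite /l1_objective -!addeA -!EFinN -!EFinD.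
apply: leeD; first exact: generator_block_restrict.
by rewrite lee_fin ![- _ + _]addrC linear_l1_block_restrict.
Qed.

Lemma tr_inner_block_restrict (R : realType) (p : nat) (K : eqType)
    (c : 'I_p -> K) (x theta : symM R p) :
  tr_inner (block_restrict c x) (block_restrict c theta) =
  tr_inner x (block_restrict c theta).
Proof.
apply: eq_bigr => i _; apply: eq_bigr => j _; rewrite !block_restrictE.
by case: eqVneq => _; rewrite ?mul1r // !mul0r mulr0.
Qed.

(** * Transfer of minimizers *)

(** Each of [f] and [g] can be minimized over the image of [P] alone, and
    there they are the same function. *)
Lemma argmin_transfer (R : realType) (X : Type) (f g : X -> \bar R)
    (P : X -> X) (x : X) :
  (forall y, (f (P y) <= f y)%E) -> (forall y, (g (P y) <= g y)%E) ->
  (forall y, f (P y) = g (P y)) ->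
  argmin f x -> argmin g (P x).
Proof.
move=> fP gP fg fx y; apply: le_trans (gP y); rewrite -!fg.
exact: le_trans (fP x) (fx _).
Qed.

Theorem theorem3 (R : realType) (p : nat) (hp : (1 <= p)%N)
    (lambda : R) (hlambda : 0 <= lambda)
    (M : set (symM R p -> set (symM R p)))
    (hM : forall T, M T ->
      exists (A : symM R p -> \bar R) (C : set (symM R p)),
        [/\ generator A, penalty_support C, sign_invariant A,
            (forall theta, support_fun C theta = (lambda * l1norm theta)%:E)
          & T = expofam A C]) :
  comp_sufficient M (fun X : symM R p => slt lambda X) /\
  (forall T, M T -> forall X : symM R p,
    [set hadamard (slc lambda (abs_mx X)) (symM_val theta) | theta in T X]
      `<=` [set symM_val theta | theta in T X]).
Proof.
have lowers (A : symM R p -> \bar R) X theta : generator A -> sign_invariant A ->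
    (l1_objective lambda A X (block_restrict (cluster lambda X) theta)
       <= l1_objective lambda A X theta)%E.
  move=> [_ _ cvxA _] invA; apply: l1_objective_block_restrict => // i j.
  exact: cluster_separates.
have hM' T : M T -> exists A : symM R p -> \bar R,
    [/\ generator A, sign_invariant A &
        T = fun X => argmin (l1_objective lambda A X)].
  move=> /hM[A [C [genA _ invA suppC ->]]]; exists A; split => //.
  apply/funext => X; congr argmin; apply/funext => theta.
  by rewrite suppC.
split=> [T /hM'[A [genA invA ->]]|T /hM'[A [genA invA ->]] X _ [theta TX <-]];
    last first.
  exists (block_restrict (cluster lambda X) theta); last by rewrite hadamard_slc.
  by apply: argmin_transfer TX => // eta; exact: lowers.
pose restr (Y : 'M[R]_p) := @block_restrict R p _ (cluster lambda Y).
(* The selector solves the problem for the thresholded matrix [Y], read as a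
   symmetric matrix [X'], and restricts the solutions to the clusters of [Y],
   which can be computed from [Y] alone. *)
exists (fun T Y => [set theta | exists X' theta' : symM R p,
  [/\ symM_val X' = Y, T X' theta' & theta = restr Y theta']]).
have thresholdP (X : symM R p) (Y := restr X X) (f := l1_objective lambda A X)
    (g := l1_objective lambda A Y) :
    [/\ slt lambda X = Y, restr Y =1 restr X,
        forall theta, (g (restr X theta) <= g theta)%E
      & forall theta, f (restr X theta) = g (restr X theta)].
  have sltX : slt lambda X = Y by rewrite /slt hadamard_slc.
  have restrY : restr Y =1 restr X.
    by apply: eq_block_restrict => i j; rewrite -sltX !cluster_slt.
  split=> // theta; first by rewrite -restrY; exact: lowers.
  by rewrite /f /g /l1_objective tr_inner_block_restrict.
split=> X; have [-> restrY gP fg] := thresholdP X; last first.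
  move=> _ [X' [theta [/val_inj -> gtheta ->]]]; rewrite restrY.
  by apply: argmin_transfer gtheta => // eta; exact: lowers.
move=> [theta ftheta]; exists (restr (restr X X) (restr X theta)).
exists (restr X X), (restr X theta); split=> //.
by apply: argmin_transfer ftheta => // eta; exact: lowers.
Qed.
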